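(* Let $q$ be a prime power. We have $$\frac{1}{q}\leq\liminf_{\alpha\in\mathcal{R}_q}h(\alpha)\leq\frac{1}{q-1}$$ and $$\frac{1}{q-1}\leq\liminf_{\alpha\in\mathcal{R}_q^\times}h(\alpha)\leq\begin{cases}\frac{1}{q-2}&\text{if }q\neq 2\\ 2&\text{if }q=2.\end{cases}$$
   Context: $\mathbb{F}_q(T)$ is the rational function field over the field with $q$ elements, $\overline{\mathbb{F}_q(T)}$ a fixed algebraic closure, and $\mathbb{F}_q((T))$ the field of formal Laurent series with its $T$-adic valuation $\mathrm{ord}_0$ (normalized by $\mathrm{ord}_0(T)=1$). The minimal polynomial of $\alpha\in\overline{\mathbb{F}_q(T)}$ is the unique polynomial $f\in\mathbb{F}_q[T][x]$ that is irreducible over $\mathbb{F}_q(T)$ as a polynomial in $x$, satisfies $f(\alpha)=0$, has coefficients in $\mathbb{F}_q[T]$ with no common factor, and whose leading coefficient (in $x$) is a monic polynomial in $T$. The height is $h(\alpha)=\deg_T(f)/\deg_x(f)$. An element $\alpha$ is totally $T$-adic if its minimal polynomial splits completely over $\mathbb{F}_q((T))$; $\mathcal{T}_q$ denotes the set of all totally $T$-adic elements of $\overline{\mathbb{F}_q(T)}$ (it is a field). The conjugates of $\alpha\in\mathcal{T}_q$ are the roots of its minimal polynomial in $\mathbb{F}_q((T))$. Define the ring $\mathcal{R}_q=\{\alpha\in\mathcal{T}_q : \mathrm{ord}_0(\beta)\geq 0\text{ for all conjugates }\beta\in\mathbb{F}_q((T))\text{ of }\alpha\}$, with unit group $\mathcal{R}_q^\times=\{\alpha\in\mathcal{T}_q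 : \mathrm{ord}_0(\beta)=0\text{ for all conjugates }\beta\in\mathbb{F}_q((T))\text{ of }\alpha\}$. For a (countably infinite) subset $L\subset\overline{\mathbb{F}_q(T)}$, choose an ordering $L=\{\alpha_1,\alpha_2,\ldots\}$ and define $\liminf_{\alpha\in L}h(\alpha)=\lim_{n\to\infty}\inf\{h(\alpha_i): i\geq n\}$; this is independent of the ordering. *)

(* Defs.v *)
From HB Require Import structures.
From mathcomp Require Import all_boot all_order all_algebra.
From mathcomp Require Import all_classical all_reals all_analysis.
From mathcomp Require Import zify.

Set Implicit Arguments.
Unset Strict Implicit.
Unset Printing Implicit Defensive.

Import Order.TTheory GRing.Theory Num.Theory.

Local Open Scope classical_set_scope.
Local Open Scope ring_scope.

(* A formal Laurent series \sum_n f n * T ^ n is its coefficient function. *)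

Definition vanishes_below (F : fieldType) (v : int) (f : int -> F) : Prop :=
  forall n : int, n < v -> f n = 0.

Record laurent (F : fieldType) := Laurent {
  lcoef :> int -> F;
  _ : `[< exists v : int, vanishes_below v lcoef >] }.

HB.instance Definition _ (F : fieldType) := [isSub for @lcoef F].
HB.instance Definition _ (F : fieldType) := [Choice of laurent F by <:].

Section LaurentField.
Context {F : fieldType}.
Implicit Types (f g h : laurent F) (v w : int).

Lemma lcoefP f : exists v, vanishes_below v f.
Proof. by case: f => f /= /asboolP. Qed.

Lemma laurent_eq f g : (forall n, f n = g n) -> f = g.
Proof. by move=> fg; apply/val_inj/funext. Qed.

Lemma vanishes_below_le v w (f : int -> F) :
  v <= w -> vanishes_below w f -> vanishes_below v f.
Proof. by move=> vw fw n nv; apply: fw; apply: lt_le_trans vw. Qed.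

Definition trunc v m (f : int -> F) : {poly F} := \poly_(i < m) f (i%:Z + v).

Lemma coef_trunc v m (f : int -> F) i : (i < m)%N -> (trunc v m f)`_i = f (i%:Z + v).
Proof. by move=> im; rewrite coef_poly im. Qed.

Lemma coefM_low (p p' q q' : {poly F}) (n : nat) :
    (forall i, (i <= n)%N -> p`_i = p'`_i) ->
    (forall i, (i <= n)%N -> q`_i = q'`_i) ->
  (p * q)`_n = (p' * q')`_n.
Proof.
move=> pp' qq'; rewrite !coefM; apply: eq_bigr => i _.
by rewrite pp' ?qq' ?leq_subr // -ltnS.
Qed.

(* Only finitely many terms of this sum are nonzero. *)
Definition lmul_coef (f g : int -> F) (n : int) : F :=
  \sum_(i \in [set: int]) f i * g (n - i).

Lemma lmul_coefE v w m (f g : int -> F) (n : nat) :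
    vanishes_below v f -> vanishes_below w g -> (n < m)%N ->
  lmul_coef f g (n%:Z + (v + w)) = (trunc v m f * trunc w m g)`_n.
Proof.
move=> fv gw nm; rewrite /lmul_coef.
pose r : seq int := [seq (j%:Z + v)%R | j <- iota 0 n.+1].
have ur : uniq r.
  rewrite map_inj_uniq ?iota_uniq // => i j /= /addIr; by case.
rewrite -(@fsbig_widen _ _ _ _ [set` r]) //; last first.
  move=> i /= [_ ir].
  have [iv|iv] := ltP i v; first by rewrite fv // mul0r.
  have [nwi|nwi] := ltP (n%:Z + (v + w) - i) w; first by rewrite gw // mulr0.
  case: ir => /=; apply/mapP; exists `|i - v|%N; last by lia.
  by rewrite mem_iota; lia.
rewrite -fsbig_seq // big_map coefM.
rewrite -[iota 0 n.+1]/(index_iota 0 n.+1) big_mkord; apply: eq_bigr => i _.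
have im : (i < m)%N := leq_trans (ltn_ord i) nm.
rewrite (coef_trunc v f im) coef_trunc ?(leq_ltn_trans _ nm) ?leq_subr //.
by congr (_ * g _); have := ltn_ord i; lia.
Qed.

Lemma lmul_coef_below v w (f g : int -> F) :
    vanishes_below v f -> vanishes_below w g ->
  vanishes_below (v + w) (lmul_coef f g).
Proof.
move=> fv gw n nvw; apply: fsbig1 => i _.
have [iv|iv] := ltP i v; first by rewrite fv // mul0r.
by rewrite gw ?mulr0 //; lia.
Qed.

Fact ladd_subproof f g :
  `[< exists v, vanishes_below v (fun n => f n + g n) >].
Proof.
apply/asboolP; have [v fv] := lcoefP f; have [w gw] := lcoefP g.
exists (Num.min v w) => n; rewrite lt_min => /andP[nv nw].
by rewrite fv // gw // addr0.
Qed.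
Definition ladd f g : laurent F := Laurent (ladd_subproof f g).

Fact lopp_subproof f : `[< exists v, vanishes_below v (fun n => - f n) >].
Proof.
apply/asboolP; have [v fv] := lcoefP f.
by exists v => n nv; rewrite fv // oppr0.
Qed.
Definition lopp f : laurent F := Laurent (lopp_subproof f).

Fact lmul_subproof f g : `[< exists v, vanishes_below v (lmul_coef f g) >].
Proof.
apply/asboolP; have [v fv] := lcoefP f; have [w gw] := lcoefP g.
by exists (v + w); apply: lmul_coef_below.
Qed.
Definition lmul f g : laurent F := Laurent (lmul_subproof f g).

Fact lpoly_subproof (p : {poly F}) :
  `[< exists v, vanishes_below v
        (fun n => if n is Posz k then p`_k else 0) >].
Proof. by apply/asboolP; exists 0; case. Qed.
Definition laurent_of_poly (p : {poly F}) : laurent F :=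
  Laurent (lpoly_subproof p).

Lemma lpoly_below p : vanishes_below 0 (laurent_of_poly p).
Proof. by case. Qed.

Lemma laddA : associative ladd.
Proof. by move=> f g h; apply: laurent_eq => n /=; rewrite addrA. Qed.
Lemma laddC : commutative ladd.
Proof. by move=> f g; apply: laurent_eq => n /=; rewrite addrC. Qed.
Lemma ladd0 : left_id (laurent_of_poly 0) ladd.
Proof.
by move=> f; apply: laurent_eq => -[n|n] /=; rewrite ?coef0 add0r.
Qed.
Lemma laddN : left_inverse (laurent_of_poly 0) lopp ladd.
Proof.
by move=> f; apply: laurent_eq => -[n|n] /=; rewrite ?coef0 addNr.
Qed.

HB.instance Definition _ :=
  GRing.isZmodule.Build (laurent F) laddA laddC ladd0 laddN.

Lemma eq_from v (f g : int -> F) :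
    vanishes_below v f -> vanishes_below v g ->
    (forall n : nat, f (n%:Z + v) = g (n%:Z + v)) ->
  forall n, f n = g n.
Proof.
move=> fv gv fg n; have [nv|nv] := ltP n v; first by rewrite fv ?gv.
have -> : n = `|n - v|%N%:Z + v by lia.
exact: fg.
Qed.

Lemma lmulA : associative lmul.
Proof.
move=> f g h; apply: laurent_eq.
have [u fu] := lcoefP f; have [v gv] := lcoefP g; have [w hw] := lcoefP h.
have fgb := lmul_coef_below fu gv; have ghb := lmul_coef_below gv hw.
apply: (@eq_from (u + (v + w))); first exact: lmul_coef_below.
  by rewrite addrA; apply: lmul_coef_below.
move=> n /=; rewrite (lmul_coefE fu ghb (ltnSn n)) [u + _]addrA.
rewrite (lmul_coefE fgb hw (ltnSn n)).
rewrite (@coefM_low _ (trunc u n.+1 f) _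
  (trunc v n.+1 g * trunc w n.+1 h)) //; last first.
  by move=> i ni; rewrite coef_trunc //=; apply: lmul_coefE.
rewrite mulrA; apply: coefM_low => // i ni.
by rewrite coef_trunc //=; symmetry; apply: lmul_coefE.
Qed.

Lemma lmulC : commutative lmul.
Proof.
move=> f g; apply: laurent_eq.
have [u fu] := lcoefP f; have [v gv] := lcoefP g.
apply: (@eq_from (u + v)); first exact: lmul_coef_below.
  by rewrite addrC; apply: lmul_coef_below.
move=> n /=; rewrite (lmul_coefE fu gv (ltnSn n)) mulrC [u + v]addrC.
by rewrite (lmul_coefE gv fu (ltnSn n)).
Qed.

Lemma trunc_lpoly m p i : (i < m)%N -> (trunc 0 m (laurent_of_poly p))`_i = p`_i.
Proof. by move=> im; rewrite coef_trunc // addr0. Qed.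

Lemma lmul1 : left_id (laurent_of_poly 1) lmul.
Proof.
move=> f; apply: laurent_eq; have [u fu] := lcoefP f.
have b1 := @lpoly_below 1.
apply: (@eq_from (0 + u)); first exact: lmul_coef_below.
  by rewrite add0r.
move=> n /=; rewrite (lmul_coefE b1 fu (ltnSn n)).
rewrite (@coefM_low _ 1 _ (trunc u n.+1 f)) //; last first.
  by move=> i ni; rewrite trunc_lpoly.
by rewrite mul1r coef_trunc // add0r.
Qed.

Lemma lmulDl : left_distributive lmul ladd.
Proof.
move=> f g h; apply: laurent_eq.
have [u fu] := lcoefP f; have [v gv] := lcoefP g; have [w hw] := lcoefP h.
pose t := Num.min u v.
have {}fu : vanishes_below t f.
  by apply: vanishes_below_le fu; rewrite /t; lia.
have {}gv : vanishes_below t g.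
  by apply: vanishes_below_le gv; rewrite /t; lia.
have fgb : vanishes_below t (ladd f g) by move=> n nt /=; rewrite fu // gv // addr0.
apply: (@eq_from (t + w)); first exact: lmul_coef_below.
  by move=> n nt /=; rewrite !(@lmul_coef_below t w) // addr0.
move=> n /=; rewrite (lmul_coefE fgb hw (ltnSn n)).
rewrite (lmul_coefE fu hw (ltnSn n)) (lmul_coefE gv hw (ltnSn n)).
rewrite -coefD -mulrDl; apply: coefM_low => // i ni.
by rewrite coefD !coef_trunc.
Qed.

Lemma lpoly_inj : injective laurent_of_poly.
Proof.
move=> p q pq; apply/polyP => i.
by have := congr1 (fun f : laurent F => f (Posz i)) pq.
Qed.

Lemma lone_neq0 : laurent_of_poly 1 != 0.
Proof. by apply/eqP => /lpoly_inj /eqP; rewrite oner_eq0. Qed.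

HB.instance Definition _ := GRing.Zmodule_isComNzRing.Build (laurent F)
  lmulA lmulC lmul1 lmulDl lone_neq0.

Lemma laurent_of_poly_is_zmod_morphism : zmod_morphism laurent_of_poly.
Proof.
by move=> p q; apply: laurent_eq => -[n|n] /=; rewrite ?coefB ?subr0.
Qed.

Lemma laurent_of_poly_is_monoid_morphism : monoid_morphism laurent_of_poly.
Proof.
split=> // p q; apply: laurent_eq.
have bp := @lpoly_below p; have bq := @lpoly_below q.
have be := @lpoly_below (p * q); apply: (@eq_from (0 + 0)) => //.
  exact: lmul_coef_below.
move=> n; rewrite [RHS](lmul_coefE bp bq (ltnSn n)) !addr0 /=.
by apply: coefM_low => i ni; rewrite trunc_lpoly.
Qed.

HB.instance Definition _ :=
  GRing.isZmodMorphism.Build {poly F} (laurent F) laurent_of_poly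
    laurent_of_poly_is_zmod_morphism.
HB.instance Definition _ :=
  GRing.isMonoidMorphism.Build {poly F} (laurent F) laurent_of_poly
    laurent_of_poly_is_monoid_morphism.

Definition is_order f (n : int) : Prop := f n != 0 /\ vanishes_below n f.

Lemma is_order_exists f : f != 0 -> exists v, is_order f v.
Proof.
move=> f0; have [w fw] := lcoefP f.
have [n fn] : exists n : nat, f (n%:Z + w) != 0.
  apply: contrapT => nf; move/eqP: f0; apply; apply: laurent_eq.
  apply: (@eq_from w) => // [k _|n]; first by case: k => //= k; rewrite coef0.
  rewrite [RHS](_ : _ = 0); last by case: (_ + _) => //= k; rewrite coef0.
  by apply/eqP/negPn/negP => fn; apply: nf; exists n.
have := ex_minnP (ex_intro (fun n : nat => f (n%:Z + w) != 0) n fn).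
case=> m fm mmin; exists (m%:Z + w); split=> // k km.
have [kw|kw] := ltP k w; first exact: fw.
apply/eqP/negPn/negP => fk.
have := mmin `|k - w|%N.
rewrite (_ : `|k - w|%N%:Z + w = k); last by lia.
by move=> /(_ fk); lia.
Qed.

Fixpoint inv_coefs (u : nat -> F) (n : nat) : seq F :=
  if n is m.+1 then
    let s := inv_coefs u m in
    rcons s (((m == 0%N)%:R - \sum_(i < m) s`_i * u (m - i)%N) / u 0%N)
  else [::].

Lemma size_inv_coefs u n : size (inv_coefs u n) = n.
Proof. by elim: n => //= n IH; rewrite size_rcons IH. Qed.

Lemma nth_inv_coefs u n m i : (i < n)%N -> (n <= m)%N ->
  (inv_coefs u m)`_i = (inv_coefs u n)`_i.
Proof.
move=> ni; elim: m => [|m IH]; first by case: n ni.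
rewrite leq_eqVlt => /orP[/eqP->//|]; rewrite ltnS => nm.
by rewrite /= nth_rcons size_inv_coefs (leq_trans ni nm) IH.
Qed.

Lemma inv_coefsP u n m : u 0%N != 0 -> (n < m)%N ->
  \sum_(i < n.+1) (inv_coefs u m)`_i * u (n - i)%N = (n == 0%N)%:R.
Proof.
move=> u0 nm; rewrite big_ord_recr /= subnn.
rewrite (@nth_inv_coefs u n.+1 m n) //= nth_rcons size_inv_coefs ltnn eqxx.
rewrite divfK //; set S' := \sum_(i < n) _.
suff -> : S' = \sum_(i < n) (inv_coefs u n)`_i * u (n - i)%N by rewrite addrC subrK.
by apply: eq_bigr => i _; rewrite (@nth_inv_coefs u n m) // ltnW.
Qed.

Lemma linv_exists f : f != 0 -> exists g, g * f = 1.
Proof.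
move=> /is_order_exists [v [fv0 fv]].
pose u (n : nat) := f (n%:Z + v).
have u0 : u 0%N != 0 by rewrite /u add0r.
pose gc (n : int) := if n + v is Posz k then (inv_coefs u k.+1)`_k else 0.
have gb : vanishes_below (- v) gc.
  by move=> n nv; rewrite /gc; case E: (n + v) => [k|k] //; lia.
have gP : `[< exists w, vanishes_below w gc >].
  by apply/asboolP; exists (- v).
exists (Laurent gP); apply: laurent_eq.
have b1 := @lpoly_below 1.
apply: (@eq_from (- v + v)) => [||n]; first exact: lmul_coef_below.
  by rewrite addNr.
rewrite [LHS](lmul_coefE gb fv (ltnSn n)) addNr addr0 /= coef1.
rewrite -(@inv_coefsP u n n.+1) // coefM; apply: eq_bigr => i _.
rewrite !coef_trunc ?ltnS ?leq_subr // -1?ltnS // /gc subrK.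
by rewrite (@nth_inv_coefs u i.+1 n.+1).
Qed.

Definition linv f : laurent F := xget 0 [set g | g * f = 1].

Lemma linvV f : f != 0 -> linv f * f = 1.
Proof.
move=> /linv_exists[g gf]; rewrite /linv; by case: xgetP => [_ -> //|/(_ g)].
Qed.

Lemma linv0 : linv 0 = 0.
Proof.
rewrite /linv; case: xgetP => // g -> /=.
by rewrite mulr0 => /esym/eqP; rewrite oner_eq0.
Qed.

HB.instance Definition _ := GRing.ComNzRing_isField.Build (laurent F) linvV linv0.

End LaurentField.

(* T-adic valuation, normalized by ord0 T = 1, with ord0 0 = +oo. *)
Definition ord0 (F : fieldType) (f : laurent F) : \bar int :=
  if f == 0 then +oo%E else (xget 0 [set n | is_order f n])%:E.

Definition is_algebraic_closure (k : fieldType) (K : closedFieldType)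
  (iota : {rmorphism k -> K}) : Prop := integralRange iota.

Section TotallyTadic.
Context {F : finFieldType} {K : closedFieldType}.
Context (iota : {rmorphism {fraction {poly F}} -> K}).

(* Inner polynomials are in T, the outer one is in x. *)
Definition is_minimal_polynomial (f : {poly {poly F}}) (a : K) : Prop :=
  [/\ irreducible_poly (map_poly (@tofrac _) f),
      root (map_poly iota (map_poly (@tofrac _) f)) a,
      forall d : {poly F}, (forall i, d %| f`_i) -> d \is a GRing.unit
    & lead_coef f \is monic].

(* Exactly one f satisfies is_minimal_polynomial f a; the default 0 of xget is
   never used when iota is an algebraic closure. *)
Definition minimal_polynomial (a : K) : {poly {poly F}} :=
  xget 0 [set f | is_minimal_polynomial f a].

(* Both size and sizeY exceed the corresponding degree by one. *)
Definition height (R : realType) (a : K) : R :=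
  (sizeY (minimal_polynomial a)).-1%:R / (size (minimal_polynomial a)).-1%:R.

Definition laurent_minimal_polynomial (a : K) : {poly laurent F} :=
  map_poly laurent_of_poly (minimal_polynomial a).

Definition totally_Tadic : set K :=
  [set a | exists rs : seq (laurent F),
     laurent_minimal_polynomial a =
       lead_coef (laurent_minimal_polynomial a) *:
         \prod_(r <- rs) ('X - r%:P)].

Definition conjugate (a : K) (b : laurent F) : Prop :=
  root (laurent_minimal_polynomial a) b.

Definition integral_Tadic : set K :=
  [set a | totally_Tadic a /\ forall b, conjugate a b -> (0 <= ord0 b)%E].

Definition unit_Tadic : set K :=
  [set a | totally_Tadic a /\ forall b, conjugate a b -> ord0 b = 0%E].

End TotallyTadic.

(* L is countably infinite iff some e satisfies set_bij; e is then an ordering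
   of L without repetition. *)
Definition ordering (K : nmodType) (L : set K) : nat -> K :=
  xget (fun=> 0) [set e | set_bij [set: nat] L e].

Definition liminf_over (K : nmodType) (R : realType) (L : set K) (h : K -> R) :
    \bar R :=
  limn_einf (fun n => (h (ordering L n))%:E).

(* Main.v *)
Require Import Defs.
From HB Require Import structures.
From mathcomp Require Import all_boot all_order all_algebra.
From mathcomp Require Import all_classical all_reals all_analysis.
From mathcomp Require Import pgroup abelian finfield.
From mathcomp Require Import generic_quotient.
From mathcomp Require Import zify ring.

(** Write q for the number of elements of F, O for the ring of power series in
    the Laurent field, and let f be the minimal polynomial of an element a, of
    degree d in x and m in T, so that the height of a is m / d.

    Lower bounds.  Suppose that f splits over the Laurent field with all roots
    in O.  Every root r is congruent modulo T to a constant c of F, so T divides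
    c - r in O.  Since f(c) is the leading coefficient times the product of the
    c - r, the product G of the values f(c) over all c in F is a polynomial in T
    divisible by T ^ d.  Each f(c) has degree at most m, so if G is nonzero then
    d <= q m, that is m / d >= 1 / q; and G vanishes only if a itself lies in F,
    which excludes finitely many elements.  If all roots are units the class
    c = 0 does not occur and q - 1 replaces q.  This is
    degree_le_of_residues and residue_height_bound.

    Upper bounds.  Let A be a polynomial in x over F[T], of degree e > 1 in x and
    at most b in T, and let phi = A / T ^ b.  Let S be a set of Laurent series
    such that phi^-1 (r) consists of e elements of S whenever r is in S.  Then
    for y in S the equation phi^n (x) = y has all its solutions in S.  Clearing
    denominators gives a polynomial of degree e ^ n in x and of degree at most
    deg y + b (1 + e + ... + e ^ (n - 1)) in T, so the ratio of the two degrees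
    tends to b / (e - 1).  This polynomial may be reducible, but degrees in x and
    in T are both additive on factors, so some irreducible factor has a ratio
    which is no larger (exists_small_height_root); a root of that factor is
    totally T-adic with all conjugates in S.  To avoid a finite set Z, choose
    among more than #|Z| candidates y one which is not in phi^n (Z).  Three maps
    give the three bounds:
      - (x ^ q - x) / T on O, with limit 1 / (q - 1);
      - (x ^ (q - 1) - 1) / T on the units of O, with limit 1 / (q - 2), q > 2;
      - 1 + beta ^ 2 - beta with beta = (x - 1) / T, on units for q = 2, where
        e = b = 2 and the limit is 2.
    The required preimages come from one instance of Hensel's lemma, the
    equation x ^ q = (1 + a) x + b with T dividing a and b.

    Degrees of factors in F[T][x] and in F(T)[x] are compared through Gauss's
    lemma.  The sets of elements at stake are countable because they are
    algebraic over a countable field, and infinite by the construction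
    above; a lower limit along an enumeration then only depends on what holds
    outside finite sets. *)
Set Implicit Arguments.
Unset Strict Implicit.
Unset Printing Implicit Defensive.

Import Order.TTheory GRing.Theory Num.Theory.

Local Open Scope ring_scope.

Local Notation tofracP := (map_poly (@tofrac _)).

(** * Gauss's lemma over F[T] *)
Lemma eqp_irreducible (L : fieldType) (p q : {poly L}) :
  p %= q -> irreducible_poly p -> irreducible_poly q.
Proof.
move=> pq [p1 irr]; split; first by rewrite -(eqp_size pq).
move=> d d1; rewrite -(eqp_dvdr d pq) => /(irr d d1) dp.
exact: eqp_trans dp pq.
Qed.

(** A nonconstant divisor of least degree is irreducible. *)
Lemma exists_irreducible_factor (L : fieldType) (c : {poly L}) :
  (1 < size c)%N -> exists2 p : {poly L}, irreducible_poly p & p %| c.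
Proof.
move=> c1; pose has_factor n := `[< exists d : {poly L}, size d = n.+2 /\ d %| c >].
have [|n /asboolP[d [sd dc]] min] := @ex_minnP has_factor.
  by exists (size c).-2; apply/asboolP; exists c; split; [lia|].
exists d => //; split=> [|e e1 ed]; first by rewrite sd.
have c0 : c != 0 by rewrite -size_poly_gt0; lia.
have ec := dvdp_trans ed dc; have e0 : e != 0 by apply: dvdpN0 ec c0.
rewrite -size_poly_gt0 in e0; have {}e1 : size e <> 1%N by apply/eqP.
have ne : (n <= (size e).-2)%N.
  apply: min; apply/asboolP; exists e; split=> //.
  by case: (size e) e0 e1 => [|[]].
rewrite -dvdp_size_eqp // eqn_leq dvdp_leq //; last exact: dvdpN0 dc c0.
by rewrite sd; lia.
Qed.

Section Gauss.
Context {F : fieldType}.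
Implicit Types (c d : {poly F}) (f g P Q : {poly {poly F}}).

Definition primitive f := forall d, (forall i, d %| f`_i) -> d \is a GRing.unit.

(** The argument that F[T]/(c) is a domain: if i and j are the first indices at
    which c fails to divide the coefficients of f and g, then c does not divide
    the coefficient of index i + j of f * g. *)
Lemma irreducible_dvd_coefM c f g : irreducible_poly c ->
    (forall i, c %| (f * g)`_i) ->
  (forall i, c %| f`_i) \/ (forall i, c %| g`_i).
Proof.
move=> irr cfg; apply: contrapT => /not_orP[/existsNP[i0 /negP fi0] /existsNP[j0 /negP gj0]].
have [i fi imin] := ex_minnP (ex_intro (fun i => ~~ (c %| f`_i)) i0 fi0).
have [j gj jmin] := ex_minnP (ex_intro (fun i => ~~ (c %| g`_i)) j0 gj0).
have := cfg (i + j)%N; have ii : (i < (i + j).+1)%N by lia.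
rewrite coefM (bigD1 (Ordinal ii)) //= addKn dvdp_addl; last first.
  apply: (big_ind (fun p => c %| p)); [exact: dvdp0|exact: dvdp_add|move=> k ki].
  have [ki'|ki'] := ltnP k i.
    by apply: dvdp_mulr; apply: contraTT ki' => /imin; rewrite -leqNgt.
  apply: dvdp_mull; apply: contraT => /jmin.
  have /eqP ki2 : (nat_of_ord k) != i by apply: contraNneq ki => E; apply/eqP/val_inj.
  have := ltn_ord k; lia.
have cop : coprimep c f`_i.
  rewrite /coprimep; apply: contraNT fi => gcd1.
  rewrite -(eqp_dvdl _ (irr _ gcd1 (dvdp_gcdl _ _))); exact: dvdp_gcdr.
by rewrite Gauss_dvdpr // (negPf gj).
Qed.

(** The irreducible factors of the denominator c divide f * Q, hence Q since f
    is primitive, so they cancel one at a time. *)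
Lemma gauss c f P Q : primitive f -> c != 0 -> c *: P = f * Q ->
  exists Q', P = f * Q'.
Proof.
move=> prf; have [n] := ubnP (size c); elim: n => // n IH in c Q *.
rewrite ltnS => cn c0 cP.
have [c1|c1] := leqP (size c) 1.
  have [a a0 ca] : exists2 a : F, a != 0 & c = a%:P.
    by exists c`_0; [|exact: size1_polyC]; rewrite -polyC_eq0 -size1_polyC.
  exists (a^-1%:P *: Q); rewrite -scalerAr -cP ca scalerA -polyCM mulVf //.
  by rewrite scale1r.
have [p irr pc] := exists_irreducible_factor c1.
have [|pf|pQ] := @irreducible_dvd_coefM p f Q irr.
- by move=> i; rewrite -cP coefZ dvdp_mulr.
- by have := prf p pf; rewrite poly_unitE; case: (irr) => + _; move: (size p) => x; lia.
have [c' cE] : exists c', c = c' * p by exists (c %/ p); rewrite divpK.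
pose Q' := \poly_(i < size Q) (Q`_i %/ p).
have QE : Q = p *: Q'.
  apply/polyP => i; rewrite coefZ coef_poly; case: ltnP => iQ.
    by rewrite mulrC divpK.
  by rewrite mulr0 nth_default.
have p0 := irredp_neq0 irr.
apply: (IH c' Q').
- have c'0 : c' != 0 by apply: contraNneq c0 => c'0; rewrite cE c'0 mul0r.
  move: cn; rewrite cE size_mul //; move: c'0; rewrite -size_poly_gt0.
  case: (irr) => + _.
  move: (size c') (size p) => x y; lia.
- by apply: contraNneq c0 => c'0; rewrite cE c'0 mul0r.
- have pP0 : p%:P != 0 :> {poly {poly F}} by rewrite polyC_eq0.
  by apply: (mulfI pP0); rewrite !mul_polyC scalerAr -QE scalerA mulrC -cE.
Qed.

Lemma fraction_eq_div (a : {fraction {poly F}}) :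
  exists c d, d != 0 /\ tofrac d * a = tofrac c.
Proof.
elim/quotW: a => x; exists (frac x).1, (frac x).2; split; first exact: denom_ratioP.
unlock tofrac; rewrite -[LHS]FracField.pi_mul.
apply/eqmodP => /=; rewrite FracField.equivfE /FracField.mulf.
by rewrite !numden_Ratio ?oner_eq0 ?mul1r ?mulr1 // denom_ratioP.
Qed.

Lemma clear_denominators (p : {poly {fraction {poly F}}}) :
  exists c f, c != 0 /\ tofrac c *: p = tofracP f.
Proof.
elim/poly_ind: p => [|p a [c [f [c0 cp]]]].
  by exists 1, 0; rewrite oner_eq0 scaler0 rmorph0.
have [n [d [d0 da]]] := fraction_eq_div a.
exists (c * d), (d *: f * 'X + (c * n)%:P); split; first by rewrite mulf_neq0.
rewrite rmorphD [X in _ = X + _]rmorphM /= map_polyX map_polyC map_polyZ /= -cp.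
rewrite [tofrac (c * d)]rmorphM [tofrac (c * n)]rmorphM /= -da -!mul_polyC !polyCM.
by move: (tofrac c)%:P (tofrac d)%:P a%:P {cp} p => x y z t; ring.
Qed.

(** The content d is a common divisor of the coefficients of largest degree. *)
Lemma exists_primitive_part f : f != 0 ->
  exists d g, [/\ d != 0, f = d *: g & primitive g].
Proof.
move=> f0; pose is_div n := `[< exists d, size d = n /\ forall i, d %| f`_i >].
have l0 : lead_coef f != 0 by rewrite lead_coef_eq0.
have bound d : (forall i, d %| f`_i) -> (size d <= size (lead_coef f))%N.
  by move=> df; apply: dvdp_leq l0 (df _).
have [||n /asboolP[d [sd df]] max] := @ex_maxnP is_div (size (lead_coef f)).
- by exists (size (1 : {poly F})); apply/asboolP; exists 1; split=> // i; exact: dvd1p.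
- by move=> n /asboolP[d [<- df]]; exact: bound.
have d0 : d != 0 by apply: contraTneq (df (size f).-1) => ->; rewrite dvd0p.
pose g := \poly_(i < size f) (f`_i %/ d).
have fE : f = d *: g.
  apply/polyP => i; rewrite coefZ coef_poly; case: ltnP => iQ.
    by rewrite mulrC divpK.
  by rewrite mulr0 nth_default.
exists d, g; split=> // e eg.
have g0 : g != 0 by apply: contraNneq f0 => g0; rewrite fE g0 scaler0.
have e0 : e != 0.
  by apply: contraTneq (eg (size g).-1) => ->; rewrite dvd0p lead_coef_eq0.
have : is_div (size (d * e)).
  by apply/asboolP; exists (d * e); split=> // i; rewrite fE coefZ dvdp_mul2l.
move=> /max; rewrite size_mul // => se.
rewrite poly_unitE; move: d0 e0; rewrite -!size_poly_gt0 => d0 e0.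
have s1 : size e = 1%N.
  by move: se d0 e0; rewrite -sd; move: (size d) (size e) => x y; lia.
by rewrite s1 eqxx /= unitfE -[0%N]/(1.-1) -s1 lead_coef_eq0 -size_poly_gt0.
Qed.

Lemma tofracP_inj : injective (map_poly (@tofrac {poly F})).
Proof. by apply: map_inj_poly => [x y /eqP|]; rewrite ?tofrac_eq ?tofrac0 // => /eqP. Qed.

End Gauss.

(** * Minimal polynomials *)
Lemma eqp_of_scale (L : fieldType) (c d : L) (p q : {poly L}) :
  c != 0 -> d != 0 -> c *: p = d *: q -> p %= q.
Proof. by move=> c0 d0 cpdq; apply/eqpP; exists (c, d); rewrite //= c0 d0. Qed.

Section MinimalPolynomial.
Context {F : finFieldType} {K : closedFieldType}.
Context (iota : {rmorphism {fraction {poly F}} -> K}).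
Implicit Types (f g P Q : {poly {poly F}}) (a : K).

Definition evalK : {poly {poly F}} -> {poly K} :=
  map_poly (iota \o @tofrac {poly F}).

Lemma evalKE f : evalK f = map_poly iota (tofracP f).
Proof. by rewrite /evalK -map_poly_comp. Qed.

(** A polynomial over F(T) of least degree vanishing at a is irreducible; the
    primitive part of a multiple in F[T][x] is then made monic in T. *)
Lemma exists_minimal_polynomial a : is_algebraic_closure iota ->
  exists f, is_minimal_polynomial iota f a.
Proof.
move=> alg.
pose has_root n := `[< exists p : {poly {fraction {poly F}}},
   [/\ size p = n.+1 & root (map_poly iota p) a] >].
have [|n /asboolP[p [sp pa]] min] := @ex_minnP has_root.
  have [p pm pa] := alg a; exists (size p).-1; apply/asboolP; exists p; split=> //.
  by rewrite prednK // size_poly_gt0 monic_neq0.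
have p0 : p != 0 by rewrite -size_poly_gt0 sp.
have irr : irreducible_poly p.
  split.
    rewrite sp ltnS lt0n; apply: contraTneq pa => n0.
    have /size_poly1P[c c0 ->] : size p == 1%N by rewrite sp n0.
    by rewrite map_polyC rootC /= fmorph_eq0.
  move=> d d1 dp; have d0 : d != 0 by apply: dvdpN0 dp p0.
  have small e : e != 0 -> root (map_poly iota e) a -> (size p <= size e)%N.
    rewrite -size_poly_gt0 sp => e0 ea; rewrite -(prednK e0) ltnS; apply: min.
    by apply/asboolP; exists e; rewrite prednK.
  have pE := divpK dp; have e0 : p %/ d != 0 by rewrite dvdp_div_eq0.
  have : root (map_poly iota (p %/ d * d)) a by rewrite pE.
  rewrite rmorphM rootM /= => /orP[ea|da].
    have := small _ e0 ea; rewrite -{1}pE size_mul //.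
    move: d0 e0 d1; rewrite -!size_poly_gt0 => d0 e0 /eqP d1.
    have {}d1 : size d <> 1%N by [].
    by move: (size d) (size (p %/ d)) d0 e0 d1 => x y; lia.
  by rewrite -dvdp_size_eqp // eqn_leq dvdp_leq //= small.
have [c [f [c0 cp]]] := clear_denominators p.
have cF0 : tofrac c != 0 by rewrite tofrac_eq0.
have f0 : f != 0.
  apply: contraNneq p0 => f0; move/eqP: cp.
  by rewrite f0 rmorph0 scaler_eq0 (negPf cF0).
have [d [g [d0 fE prg]]] := exists_primitive_part f0.
have g0 : g != 0 by apply: contraNneq f0 => g0; rewrite fE g0 scaler0.
have [u uE] : exists u, u = lead_coef (lead_coef g) by exists (lead_coef (lead_coef g)).
have u0 : u != 0 by rewrite uE !lead_coef_eq0.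
have du0 : tofrac (d * u%:P) != 0.
  by rewrite tofrac_eq0; apply: mulf_neq0 => //; rewrite polyC_eq0.
have pg : p %= tofracP (u^-1%:P *: g).
  apply: (eqp_of_scale cF0 du0).
  rewrite cp -map_polyZ scalerA -mulrA -polyCM mulfV // mulr1.
  by rewrite fE.
exists (u^-1%:P *: g); split.
- exact: eqp_irreducible pg irr.
- by rewrite -(eqp_root (_ : map_poly iota p %= _)) // eqp_map.
- move=> e eg; apply: prg => i; apply: dvdp_trans (eg i) _.
  by rewrite coefZ mul_polyC dvdpZl ?invr_eq0.
- by rewrite lead_coefZ monicE lead_coefM lead_coefC -uE mulVf.
Qed.

Lemma minimal_polynomialP a : is_algebraic_closure iota ->
  is_minimal_polynomial iota (minimal_polynomial iota a) a.
Proof.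
move=> alg; rewrite /minimal_polynomial; case: xgetP => [_ _ //|no].
by have [f fa] := exists_minimal_polynomial a alg; case: (no f).
Qed.

(** An irreducible polynomial sharing a root with P divides it over F(T), and
    Gauss's lemma brings the quotient back into F[T][x]. *)
Lemma minimal_polynomial_dvd f a P : is_minimal_polynomial iota f a ->
  root (evalK P) a -> exists Q, P = f * Q.
Proof.
move=> [irr fa prf _] Pa.
have fP : tofracP f %| tofracP P.
  have gcd1 : size (gcdp (tofracP f) (tofracP P)) != 1.
    rewrite -[_ != _]/(~~ coprimep _ _) -(coprimep_map iota).
    apply/negP => /coprimep_root /(_ fa); rewrite -evalKE.
    by move/eqP; apply; exact/eqP.
  rewrite -(eqp_dvdl _ (irr _ gcd1 (dvdp_gcdl _ _))); exact: dvdp_gcdr.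
have [c [Q [c0 cQ]]] := clear_denominators (tofracP P %/ tofracP f).
apply: (@gauss _ c f P Q prf c0); apply: tofracP_inj.
by rewrite map_polyZ rmorphM /= -cQ -scalerAr mulrC divpK.
Qed.

End MinimalPolynomial.

(** * Valuation and Hensel's lemma for Laurent series *)
Section LaurentValuation.
Context {F : fieldType}.
Implicit Types (x y : laurent F) (v w : int).

Lemma ge_ord_zero v : vanishes_below v (0 : laurent F).
Proof. by move=> [n|n] _ //=; rewrite coef0. Qed.

Lemma ge_ordD v x y :
  vanishes_below v x -> vanishes_below v y -> vanishes_below v (x + y).
Proof. by move=> xv yv n nv; rewrite /= xv // yv // addr0. Qed.

Lemma ge_ordN v x : vanishes_below v x -> vanishes_below v (- x).
Proof. by move=> xv n nv; rewrite /= xv // oppr0. Qed.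

Lemma ge_ordB v x y :
  vanishes_below v x -> vanishes_below v y -> vanishes_below v (x - y).
Proof. by move=> xv yv; apply/ge_ordD/ge_ordN. Qed.

Lemma ge_ordM v w x y :
  vanishes_below v x -> vanishes_below w y -> vanishes_below (v + w) (x * y).
Proof. exact: lmul_coef_below. Qed.

Lemma ge_ord0_poly (p : {poly F}) : vanishes_below 0 (laurent_of_poly p).
Proof. exact: lpoly_below. Qed.

Lemma ge_ord_exp (v : nat) x n :
  vanishes_below v%:Z x -> vanishes_below (v * n)%N%:Z (x ^+ n).
Proof.
move=> xv; elim: n => [|n IH]; first by rewrite muln0; apply: ge_ord0_poly.
by rewrite exprS mulnS PoszD; apply: ge_ordM.
Qed.

Lemma ge_ord1 x : vanishes_below 0 x -> x 0 = 0 -> vanishes_below 1 x.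
Proof.
move=> x0 x00 n n1; have [nn|nn] := ltP n 0; first exact: x0.
by have -> : n = 0 by lia.
Qed.

(** The T-adic topology is separated. *)
Lemma ge_ord_eq0 x : (forall n : nat, vanishes_below n%:Z x) -> x = 0.
Proof.
move=> x0; apply: laurent_eq => n; rewrite (x0 `|n|%N.+1); last by lia.
by case: n => //= n; rewrite coef0.
Qed.

Lemma laurentTE : laurent_of_poly 'X 0 = 0 :> F.
Proof. by rewrite /= coefX. Qed.

Lemma ge_ord_T : vanishes_below 1 (laurent_of_poly 'X : laurent F).
Proof. by apply: ge_ord1 laurentTE; apply: ge_ord0_poly. Qed.

Lemma laurentT_neq0 : laurent_of_poly 'X != 0 :> laurent F.
Proof. by rewrite -[0]/(laurent_of_poly 0) (inj_eq lpoly_inj) polyX_eq0. Qed.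

Lemma ord0_eq x n : is_order x n -> Defs.ord0 x = n%:E.
Proof.
move=> [xn xv]; have x0 : x != 0.
  by apply: contraNneq xn => -> /=; case: (n) => *; rewrite ?coef0.
rewrite /Defs.ord0 (negPf x0); congr (_%:E); case: xgetP => [m _ [xm xmv]|/(_ n)[]//].
apply/eqP; rewrite eq_le; apply/andP; split; rewrite leNgt; apply/negP => lt.
  by rewrite xmv ?eqxx in xn.
by rewrite xv ?eqxx in xm.
Qed.

Lemma ord0_ge0 x : (0 <= Defs.ord0 x)%E <-> vanishes_below 0 x.
Proof.
have [->|x0] := eqVneq x 0.
  split=> [_|_]; first exact: ge_ord0_poly.
  by rewrite /Defs.ord0 eqxx.
have [n nx] := is_order_exists x0; rewrite (ord0_eq nx) lee_fin.
case: nx => xn xv; split=> [n0|x00]; first exact: vanishes_below_le xv.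
by rewrite leNgt; apply/negP => /x00 E; rewrite E eqxx in xn.
Qed.

Lemma ord0_eq0 x : Defs.ord0 x = 0%E <-> is_order x 0.
Proof.
split=> [|/ord0_eq//]; have [->|x0] := eqVneq x 0; first by rewrite /Defs.ord0 eqxx.
by have [n nx] := is_order_exists x0; rewrite (ord0_eq nx) => -[<-].
Qed.

End LaurentValuation.

Section Hensel.
Context {F : finFieldType}.
Implicit Types (x y a b : laurent F).

Lemma card_finField_gt1 : (1 < #|F|)%N.
Proof. exact: finNzRing_gt1. Qed.

(** q is a power of the characteristic, so the q-th power map is additive. *)
Lemma laurent_FrobeniusB x y : (x - y) ^+ #|F| = x ^+ #|F| - y ^+ #|F|.
Proof.
have [p pr_p pF] := finPcharP F.
have pL : p \in [pchar laurent F].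
  by have := rmorph_pchar (@laurent_of_poly F \o polyC) pF.
have qL : [pchar laurent F].-nat #|F|.
  have pq : p.-nat #|F|.
    have := fin_ring_pchar_abelem pF.
    by move=> /abelem_pgroup; rewrite /pgroup cardsT.
  apply: sub_in_pnat pq => r _; rewrite inE => /eqP -> //.
rewrite exprDn_pchar //; congr (_ + _).
by apply/eqP; rewrite -subr_eq0 opprK -exprDn_pchar // addNr expr0n; case: #|F| (ltnW card_finField_gt1).
Qed.

Lemma laurentC_Frobenius (c : F) :
  laurent_of_poly c%:P ^+ #|F| = laurent_of_poly c%:P.
Proof. by rewrite -rmorphXn -polyC_exp expf_card. Qed.

(** Because x |-> x ^ q is additive and raises valuations, the map
    H x = x ^ q - a x - b gains one digit of precision at each application, and
    fixes the constant c modulo T.  Its iterates at c converge to a fixed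
    point, which is the solution with residue c. *)
Lemma hensel a b (c : F) : vanishes_below 1 a -> vanishes_below 1 b ->
  exists x, [/\ vanishes_below 0 x, x 0 = c & x ^+ #|F| = (1 + a) * x + b].
Proof.
move=> a1 b1.
pose H x := x ^+ #|F| - a * x - b.
have q1 := card_finField_gt1.
have HB x y : H x - H y = (x - y) ^+ #|F| - a * (x - y).
  by rewrite laurent_FrobeniusB /H; ring.
have contract (n : nat) x y :
    vanishes_below n.+1%:Z (x - y) -> vanishes_below n.+2%:Z (H x - H y).
  move=> xy; rewrite HB; apply: ge_ordB.
    by apply: vanishes_below_le (ge_ord_exp xy); nia.
  by rewrite -add1n PoszD; apply: ge_ordM.
pose s n := iter n H (laurent_of_poly c%:P).
have sE n : s n.+1 = H (s n) by [].
have s0 n : vanishes_below 0 (s n).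
  elim: n => [|n IH]; first exact: ge_ord0_poly.
  rewrite sE /H; apply: ge_ordB; last exact: vanishes_below_le b1.
  apply: ge_ordB; first exact: (@ge_ord_exp _ 0).
  by apply: (@vanishes_below_le _ _ (1 + 0)) => //; apply: ge_ordM.
have sS n : vanishes_below n.+1%:Z (s n.+1 - s n).
  elim: n => [|n IH]; last by rewrite !sE; apply: contract.
  rewrite sE /H /s [iter 0 _ _]/(laurent_of_poly c%:P) laurentC_Frobenius.
  set z := laurent_of_poly _; have -> : z - a * z - b - z = - (a * z) - b by ring.
  apply: ge_ordB => //; apply: ge_ordN.
  by apply: (@vanishes_below_le _ _ (1 + 0)) => //; apply/ge_ordM/ge_ord0_poly.
have sD k n : (k <= n)%N -> vanishes_below k.+1%:Z (s n - s k).
  move=> /subnKC <-; elim: (n - k)%N => [|m IH].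
    by rewrite addn0 subrr; apply: ge_ord_zero.
  rewrite addnS -(subrKA (s (k + m)%N)); apply: ge_ordD IH.
  by apply: vanishes_below_le (sS _); lia.
(* The coefficients of index at most n no longer change after s n, so the
   limit has the diagonal coefficients. *)
pose X (n : int) := if n is Posz k then s k k else 0.
have Xb : `[< exists v, vanishes_below v X >] by apply/asboolP; exists 0; case.
pose x := Laurent Xb; exists x.
have xs n : vanishes_below n.+1%:Z (x - s n).
  move=> [k|k] kn; last by rewrite /= s0 // subr0.
  have /sD /(_ k (ltnSn k)) : (k <= n)%N by lia.
  by rewrite /= => /eqP; rewrite subr_eq0 => /eqP ->; rewrite subrr.
have x0 : vanishes_below 0 x by case.
split=> //; first by rewrite /= /s /= coefC.
have : H x - x = 0.
  apply: ge_ord_eq0 => n; rewrite -(subrKA (s n.+1)); apply: ge_ordD.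
    by apply: vanishes_below_le (contract n _ _ (xs n)); lia.
  rewrite -opprB; apply: ge_ordN.
  by apply: vanishes_below_le (xs n.+1); lia.
move=> /eqP; rewrite subr_eq0 => /eqP Hx.
have -> : x ^+ #|F| = H x + a * x + b by rewrite /H; ring.
by rewrite Hx; ring.
Qed.

End Hensel.

(** * Lower bounds for the height *)
Section LowerBound.
Context {F : finFieldType} {K : closedFieldType}.
Context (iota : {rmorphism {fraction {poly F}} -> K}).
Implicit Types (f : {poly {poly F}}) (a : K).

Lemma ge_ord_prod (x : seq (laurent F)) (n : nat) :
  (forall r, r \in x -> vanishes_below n%:Z r) ->
  vanishes_below (n * size x)%N%:Z (\prod_(r <- x) r).
Proof.
elim: x => [|r x IH] xn; first by rewrite muln0 big_nil; apply: ge_ord0_poly.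
rewrite big_cons /= mulnS PoszD; apply: ge_ordM; first by apply: xn; rewrite mem_head.
by apply: IH => s sx; apply: xn; rewrite in_cons sx orbT.
Qed.

Lemma size_laurentP f : size (map_poly laurent_of_poly f) = size f.
Proof. exact: size_map_inj_poly (@lpoly_inj F) (rmorph0 _) f. Qed.

Lemma laurentP_eq0 f : (map_poly laurent_of_poly f == 0) = (f == 0).
Proof. by rewrite -!size_poly_eq0 size_laurentP. Qed.

Lemma degree_prod_eval f (cs : seq F) :
  ((size (\prod_(c <- cs) f.[c%:P])%R).-1 <= size cs * (sizeY f).-1)%N.
Proof.
elim: cs => [|c cs IH]; first by rewrite big_nil size_poly1.
rewrite big_cons /= mulSn; have := size_polyMleq f.[c%:P] (\prod_(c <- cs) f.[c%:P]).
have := max_size_evalC f c; move: IH.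
move: (size _) (size _) (size _) (sizeY f) (size cs * _)%N => x y z t u; lia.
Qed.

(** The product G of the values of f at the constants in cs is divisible in O by
    one factor T for every root of f, and it is a nonzero polynomial in T of
    degree at most size cs times the degree of f in T. *)
Lemma degree_le_of_residues f (rs : seq (laurent F)) (cs : seq F) :
    map_poly laurent_of_poly f =
      lead_coef (map_poly laurent_of_poly f) *: \prod_(r <- rs) ('X - r%:P) ->
    f != 0 ->
    (forall r, r \in rs -> vanishes_below 0 r /\ r 0 \in cs) ->
    (forall c, c \in cs -> f.[c%:P] != 0) ->
  ((size f).-1 <= size cs * (sizeY f).-1)%N.
Proof.
move=> fE f0 rsP csP; apply: leq_trans (degree_prod_eval f cs).
set G := \prod_(c <- cs) _; have G0 : G != 0.
  by rewrite prodf_seq_neq0; apply/allP => c /csP.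
have szf : (size f).-1 = size rs.
  rewrite -size_laurentP fE size_scale ?size_prod_XsubC //.
  by rewrite lead_coef_eq0 laurentP_eq0.
rewrite szf.
have lowG : vanishes_below (size rs)%:Z (laurent_of_poly G).
  rewrite /G rmorph_prod /=.
  have hE c : laurent_of_poly f.[c%:P] = lead_coef (map_poly laurent_of_poly f) *
      \prod_(r <- rs) (laurent_of_poly c%:P - r).
    rewrite -horner_map /= fE hornerZ -fE; congr (_ * _).
    by rewrite horner_prod; apply: eq_bigr => r _; rewrite hornerXsubC.
  under eq_bigr => c _ do rewrite hE.
  rewrite big_split /= exchange_big /= -[Posz _]add0r; apply: ge_ordM.
    rewrite -(big_map (fun=> lead_coef (map_poly laurent_of_poly f)) xpredT id).
    apply: (@ge_ord_prod _ 0) => _ /mapP[c _ ->].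
    rewrite lead_coef_map_inj ?rmorph0 //; [exact: ge_ord0_poly|exact: lpoly_inj].
  rewrite -(big_map (fun r => \prod_(c <- cs) (laurent_of_poly c%:P - r)) xpredT id).
  rewrite -(size_map (fun r => \prod_(c <- cs) (laurent_of_poly c%:P - r)) rs) -[size _]mul1n.
  apply: ge_ord_prod => _ /mapP[r /rsP[r0 rc] ->].
  rewrite (big_rem _ rc); apply: (@vanishes_below_le _ _ (1 + 0)) => //.
  apply: ge_ordM.
    apply: ge_ord1; last by rewrite /= coefC subrr.
    by apply: ge_ordB r0; apply: ge_ord0_poly.
  rewrite -(big_map (fun c => laurent_of_poly c%:P - r) xpredT id).
  apply: (@ge_ord_prod _ 0) => _ /mapP[c _ ->].
  by apply: ge_ordB r0; apply: ge_ord0_poly.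
rewrite leqNgt; apply/negP => lt.
move: G0; rewrite -lead_coef_eq0 lead_coefE.
by have /= -> := lowG (size G).-1; rewrite ?eqxx.
Qed.

(** An irreducible polynomial vanishing at c is associated to 'X - c. *)
Lemma eval_minimal_polynomial_neq0 f a (c : F) : is_minimal_polynomial iota f a ->
  a != iota (tofrac c%:P) -> f.[c%:P] != 0.
Proof.
move=> [irr fa _ _]; apply: contraNneq => fc.
have rc : root (tofracP f) (tofrac c%:P).
  by rewrite rootE -[X in _.[X]]/(tofrac c%:P) horner_map fc rmorph0.
have : 'X - (tofrac c%:P)%:P %= tofracP f.
  by apply: irr; rewrite ?size_XsubC // dvdp_XsubCl.
rewrite -(eqp_map iota) => /eqp_root eqr.
by move: fa; rewrite -eqr rmorphB /= map_polyX map_polyC root_XsubC.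
Qed.

Lemma residue_height_bound (R : realType) a (cs : seq F) :
    is_algebraic_closure iota -> totally_Tadic iota a ->
    (forall b, conjugate iota a b -> vanishes_below 0 b /\ b 0 \in cs) ->
    (forall c, c \in cs -> a != iota (tofrac c%:P)) ->
  (size cs)%:R^-1 <= height iota R a.
Proof.
move=> alg [rs rsE] conj csa.
have min := minimal_polynomialP a alg; set f := minimal_polynomial iota a in min.
have [irr fa _ _] := min.
have f0 : f != 0 by have := irredp_neq0 irr; apply: contraNneq => ->; rewrite rmorph0.
have d1 : (0 < (size f).-1)%N.
  have [+ _] := irr; rewrite (size_map_inj_poly _ (rmorph0 _)); first by case: (size f) => [|[]].
  by move=> x y /eqP; rewrite tofrac_eq => /eqP.
have le : ((size f).-1 <= size cs * (sizeY f).-1)%N.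
  apply: (degree_le_of_residues rsE) => // [r rrs|c ccs].
    by apply: conj; rewrite /conjugate rsE rootZ ?root_prod_XsubC // lead_coef_eq0 laurentP_eq0.
  exact: eval_minimal_polynomial_neq0 min (csa c ccs).
have cs0 : (0 < size cs)%N by case: (size cs) le d1 => //; rewrite mul0n leqn0 => /eqP ->.
rewrite /height -/f ler_pdivlMr ?ltr0n // mulrC ler_pdivrMr ?ltr0n //.
by rewrite -natrM ler_nat mulnC.
Qed.

End LowerBound.

(** * Polynomials splitting with roots in a given set *)
Section SplittingIn.
Context {L : fieldType} (S : L -> Prop).
Implicit Types (p q : {poly L}).

Definition splits_in p : Prop := exists2 rs : seq L,
  (forall r, r \in rs -> S r) & p %= \prod_(r <- rs) ('X - r%:P).

Lemma splits_in_eqp p q : p %= q -> splits_in p -> splits_in q.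
Proof. by move=> pq [rs rsS prs]; exists rs => //; rewrite -(eqp_ltrans pq). Qed.

Lemma splits_in_dvd p q : p %| q -> splits_in q -> splits_in p.
Proof.
move=> pq [rs rsS qrs]; rewrite (eqp_dvdr _ qrs) in pq.
have [m pm] := dvdp_prod_XsubC pq.
by exists (mask m rs) => // r /mem_mask /rsS.
Qed.

Lemma splits_inM p q : splits_in p -> splits_in q -> splits_in (p * q).
Proof.
move=> [rs rsS prs] [ss ssS qss]; exists (rs ++ ss).
  by move=> r; rewrite mem_cat => /orP[/rsS|/ssS].
by rewrite big_cat /=; apply: eqp_trans (eqp_mulr _ prs) (eqp_mull _ qss).
Qed.

(** Composition with q turns each factor 'X - r of p into q - r; this is how
    preimages are followed along an iteration. *)
Lemma splits_in_comp p q : splits_in p ->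
  (forall r, S r -> splits_in (q - r%:P)) -> splits_in (p \Po q).
Proof.
move=> [rs rsS prs] qS; have /eqpP[[c d] /= /andP[c0 d0] cd] := prs.
have cdq : c *: (p \Po q) = d *: \prod_(r <- rs) (q - r%:P).
  rewrite -linearZ /= cd linearZ /= rmorph_prod /=; congr (_ *: _).
  by apply: eq_bigr => r _; rewrite rmorphB /= comp_polyX comp_polyC.
apply: (@splits_in_eqp (\prod_(r <- rs) (q - r%:P))).
  by rewrite eqp_sym; exact: (eqp_of_scale c0 d0 cdq).
elim: rs rsS {prs cd cdq} => [_|r rs IH rsS].
  by exists [::]; rewrite ?big_nil ?eqpxx.
rewrite big_cons; apply: splits_inM; first by apply/qS/rsS/mem_head.
by apply: IH => s srs; apply: rsS; rewrite in_cons srs orbT.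
Qed.

Lemma splits_in_roots p (rs : seq L) : uniq rs -> size p = (size rs).+1 ->
  (forall r, r \in rs -> root p r /\ S r) -> splits_in p.
Proof.
move=> urs szp rsP; exists rs => [r /rsP[]//|].
rewrite [p](@all_roots_prod_XsubC _ p rs) ?uniq_rootsE //; last first.
  by apply/allP => r /rsP[].
by rewrite eqp_scale // lead_coef_eq0 -size_poly_eq0 szp.
Qed.

Lemma splits_in_eq p : splits_in p -> exists2 rs : seq L,
  (forall r, r \in rs -> S r) & p = lead_coef p *: \prod_(r <- rs) ('X - r%:P).
Proof.
move=> [rs rsS prs]; exists rs => //.
have := eqp_eq prs; have /monicP -> := monic_prod_XsubC rs xpredT id.
by rewrite scale1r.
Qed.

End SplittingIn.

(** * Irreducible factors of small height *)
Section SmallFactor.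
Context {F : finFieldType} {K : closedFieldType}.
Context (iota : {rmorphism {fraction {poly F}} -> K}).
Hypothesis alg : is_algebraic_closure iota.
Implicit Types (f P Q : {poly {poly F}}) (a : K).

Lemma degreeM P Q : P != 0 -> Q != 0 ->
  (size (P * Q)).-1 = ((size P).-1 + (size Q).-1)%N.
Proof.
move=> P0 Q0; rewrite size_mul //; move: P0 Q0; rewrite -!size_poly_gt0.
by move: (size P) (size Q) => x y; lia.
Qed.

Lemma degreeYM P Q : P != 0 -> Q != 0 ->
  (sizeY (P * Q)).-1 = ((sizeY P).-1 + (sizeY Q).-1)%N.
Proof. by move=> P0 Q0; rewrite !sizeYE rmorphM /= degreeM ?swapXY_eq0. Qed.

Lemma iota_tofrac_inj : injective (iota \o @tofrac {poly F}).
Proof. by move=> x y /= /fmorph_inj /eqP; rewrite tofrac_eq => /eqP. Qed.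

Lemma size_evalK P : size (evalK iota P) = size P.
Proof. exact: size_map_inj_poly iota_tofrac_inj (rmorph0 _) P. Qed.

(** Peel off the minimal polynomial f of a root of P = f * Q.  The pair of degrees
    of P is the sum of those of f and Q, so its slope lies between theirs: either
    f has slope at most that of P, or Q does and the argument goes on with Q. *)
Lemma exists_small_height_root P : (1 < size P)%N ->
  exists2 a, root (evalK iota P) a &
    ((sizeY (minimal_polynomial iota a)).-1 * (size P).-1 <=
     (sizeY P).-1 * (size (minimal_polynomial iota a)).-1)%N.
Proof.
have [n] := ubnP (size P); elim: n => // n IH in P *; rewrite ltnS => Pn P1.
have [a Pa] : exists a, root (evalK iota P) a.
  by apply/closed_rootP; rewrite size_evalK; case: (size P) P1 => [|[]].
have amin := minimal_polynomialP a alg.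
set f := minimal_polynomial iota a in amin *.
have [Q PE] := minimal_polynomial_dvd amin Pa.
have P0 : P != 0 by rewrite -size_poly_gt0; apply: ltn_trans P1.
have f0 : f != 0 by apply: contraNneq P0 => f0; rewrite PE f0 mul0r.
have Q0 : Q != 0 by apply: contraNneq P0 => Q0; rewrite PE Q0 mulr0.
have f1 : (1 < size f)%N.
  have [[+ _] _ _ _] := amin; rewrite size_map_inj_poly ?tofrac0 //.
  by move=> x y /eqP; rewrite tofrac_eq => /eqP.
have dP := degreeM f0 Q0; have dYP := degreeYM f0 Q0; rewrite -PE in dP dYP.
have [le|lt] := leqP ((sizeY f).-1 * (size P).-1) ((sizeY P).-1 * (size f).-1).
  by exists a.
have Q1 : (1 < size Q)%N.
  move: lt; rewrite dP dYP; move: (size Q) (size f) (sizeY f) (sizeY Q) => x y z t.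
  by case: x => [|[|x]] //=; rewrite !addn0; nia.
have [|b Qb le] := IH Q _ Q1.
  by move: dP f1 Q1 P1 Pn; move: (size Q) (size f) (size P) => x y z; lia.
exists b; first by rewrite PE /evalK rmorphM rootM -/(evalK iota Q) Qb orbT.
have x0 : (0 < (size Q).-1)%N by case: (size Q) Q1 => [|[]].
rewrite dP dYP in lt *; move: le lt x0.
move: (size Q).-1 (sizeY Q).-1 (sizeY f).-1 (size f).-1 => x y z w.
move: (size (minimal_polynomial iota b)).-1 (sizeY (minimal_polynomial iota b)).-1.
move=> u v le lt x0; rewrite -(leq_pmul2r x0).
have yz : (y * w <= z * x)%N by lia.
have := leq_mul le (leqnn w); have := leq_mul yz (leqnn u).
by have := leq_mul le (leqnn x); nia.
Qed.

End SmallFactor.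

(** * Pulling back along a polynomial map divided by a power of T *)
Lemma leq_pred_add (m n m' n' : nat) :
  (m <= m' -> n <= n' -> (m + n).-1 <= (m' + n').-1)%N.
Proof. lia. Qed.

Section Pullback.
Context {F : finFieldType}.
Implicit Types (A P : {poly {poly F}}) (b : nat).

(** The polynomial P(A / T ^ b) multiplied by T ^ (b * deg P), a power of T that
    clears its denominators. *)
Definition pullback A b P : {poly {poly F}} :=
  \sum_(i < size P) ('X ^+ (b * ((size P).-1 - i)) * P`_i) *: A ^+ i.

(** In a field the denominators can be restored. This form serves the Laurent
    field, where splitting is read off, and the algebraic closure, where the
    roots are. *)
Lemma map_pullback (L : fieldType) (sigma : {rmorphism {poly F} -> L}) A b P :
    injective sigma ->
  map_poly sigma (pullback A b P) = sigma 'X ^+ (b * (size P).-1) *: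
    (map_poly sigma P \Po ((sigma 'X ^+ b)^-1 *: map_poly sigma A)).
Proof.
move=> inj; have t0 : sigma 'X != 0 by rewrite -(rmorph0 sigma) (inj_eq inj) polyX_eq0.
rewrite comp_polyE size_map_inj_poly ?rmorph0 // rmorph_sum /= scaler_sumr.
apply: eq_bigr => i _; rewrite map_polyZ rmorphXn rmorphM rmorphXn /= coef_map /=.
rewrite exprZn !scalerA; congr (_ *: _).
have iP : (i <= (size P).-1)%N by rewrite -ltnS (ltn_predK (ltn_ord i)).
rewrite mulrAC mulnBr; congr (_ * _); rewrite exprVn -exprM.
by apply: (canRL (mulfK _)); rewrite ?expf_neq0 // -exprD subnK // leq_mul2l iP orbT.
Qed.

Lemma degree_pullback A b P : (size (pullback A b P)).-1 = ((size P).-1 * (size A).-1)%N.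
Proof.
have t0 := @laurentT_neq0 F; have inj := @lpoly_inj F.
rewrite -size_laurentP map_pullback // size_scale ?expf_neq0 // size_comp_poly.
by rewrite size_scale ?invr_eq0 ?expf_neq0 // !size_laurentP.
Qed.

(** The summand of index i has degree at most b (d - i) + deg P + b i in T, where
    d is the degree of P in x. *)
Lemma degreeY_pullback A b P : (sizeY A <= b.+1)%N ->
  ((sizeY (pullback A b P)).-1 <= (sizeY P).-1 + b * (size P).-1)%N.
Proof.
move=> Ab; have [->|P0] := eqVneq P 0.
  by rewrite /pullback size_poly0 big_ord0 sizeYE rmorph0 size_poly0.
rewrite -subn1 leq_subLR add1n -addSn sizeYE rmorph_sum /=.
apply: leq_trans (size_sum _ _ _) _; apply/bigmax_leqP => i _.
rewrite -mul_polyC rmorphM rmorphXn /= swapXY_polyC.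
apply: leq_trans (size_polyMleq _ _) _.
have sA : (size (swapXY A ^+ i)%R <= (b * i).+1)%N.
  apply: leq_trans (size_poly_exp_leq _ _) _; rewrite ltnS leq_mul2r -sizeYE.
  by apply/orP; right; move: Ab; move: (sizeY A) => x; lia.
have sP : (size ('X^(b * ((size P).-1 - i)) * P`_i)^:P <= b * ((size P).-1 - i) + sizeY P)%N.
  rewrite size_map_polyC; apply: leq_trans (size_polyMleq _ _) _; rewrite size_polyXn /=.
  by rewrite leq_add2l max_size_coefXY.
have iP : (i <= (size P).-1)%N by rewrite -ltnS (ltn_predK (ltn_ord i)).
have Y0 : (0 < sizeY P)%N by rewrite lt0n sizeY_eq0.
have ij : (b * i <= b * (size P).-1)%N by rewrite leq_mul2l iP orbT.
apply: leq_trans (leq_pred_add sP sA) _; rewrite mulnBr.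
move: ij Y0; by move: (b * i)%N (b * (size P).-1)%N (sizeY P) => x y z; lia.
Qed.

Lemma splits_in_pullback (S : laurent F -> Prop) A b P :
    (forall r, S r ->
       splits_in S (map_poly laurent_of_poly A - (laurent_of_poly 'X ^+ b * r)%:P)) ->
    splits_in S (map_poly laurent_of_poly P) ->
  splits_in S (map_poly laurent_of_poly (pullback A b P)).
Proof.
move=> AS PS; have t0 := @laurentT_neq0 F; have tb0 := expf_neq0 b t0.
rewrite map_pullback; last exact: lpoly_inj.
set q := _ \Po _; apply: (@splits_in_eqp _ S q).
  by rewrite eqp_sym; apply/eqp_scale/expf_neq0.
apply: splits_in_comp PS _ => r /AS; apply: splits_in_eqp.
apply: (@eqp_of_scale _ 1 (laurent_of_poly 'X ^+ b)) => //; first exact: oner_neq0.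
by rewrite scale1r scalerBr scalerA mulfV // scale1r -[in RHS]mul_polyC polyCM.
Qed.

Fixpoint iter_pullback A b (y : {poly F}) n :=
  if n is m.+1 then pullback A b (iter_pullback A b y m) else 'X - y%:P.

Lemma degree_iter_pullback A b y n :
  (size (iter_pullback A b y n)).-1 = ((size A).-1 ^ n)%N.
Proof.
elim: n => [|n IH] /=; first by rewrite size_XsubC.
by rewrite degree_pullback IH expnSr.
Qed.

Lemma degreeY_iter_pullback A b y n : (sizeY A <= b.+1)%N ->
  ((sizeY (iter_pullback A b y n)).-1 <=
     (size y).-1 + b * \sum_(i < n) (size A).-1 ^ i)%N.
Proof.
move=> Ab; elim: n => [|n IH] /=.
  rewrite big_ord0 muln0 addn0 sizeYE rmorphB /= swapXY_X swapXY_polyC.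
  rewrite -subn1 leq_subLR; apply: leq_trans (size_polyD _ _) _.
  rewrite size_polyN size_map_polyC size_polyC polyX_eq0 /= geq_max.
  by move: (size y) => x; lia.
apply: leq_trans (degreeY_pullback _ Ab) _.
by rewrite degree_iter_pullback big_ord_recr /= mulnDr addnA leq_add2r.
Qed.

Lemma splits_in_iter_pullback (S : laurent F -> Prop) A b y n :
    (forall r, S r ->
       splits_in S (map_poly laurent_of_poly A - (laurent_of_poly 'X ^+ b * r)%:P)) ->
    S (laurent_of_poly y) ->
  splits_in S (map_poly laurent_of_poly (iter_pullback A b y n)).
Proof.
move=> AS yS; elim: n => [|n IH] /=; last exact: splits_in_pullback.
exists [:: laurent_of_poly y]; first by move=> r; rewrite inE => /eqP ->.
by rewrite rmorphB /= map_polyX map_polyC big_seq1 eqpxx.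
Qed.

Context {K : closedFieldType}.
Context (iota : {rmorphism {fraction {poly F}} -> K}).

(** The map A / T ^ b on the algebraic closure. *)
Definition dynamics A b (a : K) : K :=
  (iota (tofrac 'X) ^+ b)^-1 * (evalK iota A).[a].

Lemma root_iter_pullback A b y n a : root (evalK iota (iter_pullback A b y n)) a ->
  iter n (dynamics A b) a = iota (tofrac y).
Proof.
elim: n a => [|n IH] a /=.
  by rewrite /evalK rmorphB /= map_polyX map_polyC root_XsubC => /eqP.
rewrite -iterS iterSr => ra; apply: IH.
move: ra; rewrite /evalK map_pullback; last exact: iota_tofrac_inj.
have t0 : iota (tofrac 'X) != 0 by rewrite fmorph_eq0 tofrac_eq0 polyX_eq0.
by rewrite rootZ ?expf_neq0 // rootE horner_comp hornerZ.
Qed.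

End Pullback.

(** * Totally T-adic elements of small height outside a finite set *)
Section TotallyTadicIn.
Context {F : finFieldType} {K : closedFieldType}.
Context (iota : {rmorphism {fraction {poly F}} -> K}).
Hypothesis alg : is_algebraic_closure iota.

(** The common form of the ring of integral totally T-adic elements and of its
    group of units: S is the condition imposed on the conjugates. *)
Definition tadic_in (S : laurent F -> Prop) (a : K) : Prop :=
  totally_Tadic iota a /\ forall b, conjugate iota a b -> S b.

(** P need not be irreducible: its irreducible factors split with roots in S as
    soon as it does. *)
Lemma tadic_in_root (S : laurent F -> Prop) (P : {poly {poly F}}) (a : K) :
    root (evalK iota P) a -> splits_in S (map_poly laurent_of_poly P) ->
  tadic_in S a.
Proof.
move=> Pa PS; have amin := minimal_polynomialP a alg.
have [Q PE] := minimal_polynomial_dvd amin Pa.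
have [|rs rsS fE] := @splits_in_eq _ S (laurent_minimal_polynomial iota a).
  by apply: splits_in_dvd PS; rewrite PE rmorphM dvdp_mulIl.
have [[f1 _] _ _ _] := amin.
split; first by exists rs.
move=> r; rewrite /conjugate fE rootZ ?root_prod_XsubC; first exact: rsS.
rewrite lead_coef_eq0 laurentP_eq0; apply: contraTneq f1 => ->.
by rewrite rmorph0 size_poly0.
Qed.

Lemma size_minimal_polynomial a : (1 < size (minimal_polynomial iota a))%N.
Proof.
have [[+ _] _ _ _] := minimal_polynomialP a alg; rewrite size_map_inj_poly ?tofrac0 //.
by move=> x y /eqP; rewrite tofrac_eq => /eqP.
Qed.

(** The values iota (1 + T ^ (i + 1)) are pairwise distinct, and the image of Z
    under phi contains at most size Z of them.  The degree in T of the value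
    obtained is bounded in terms of Z alone, whatever the map phi. *)
Lemma exists_value_outside (phi : K -> K) (Z : seq K) :
  exists2 i, (i <= size Z)%N &
    forall a, phi a = iota (tofrac (1 + 'X ^+ i.+1 : {poly F})) -> a \notin Z.
Proof.
pose v i := iota (tofrac (1 + 'X ^+ i.+1 : {poly F})).
apply: contrapT => no; have : (size (map v (seq.iota 0 (size Z).+1)) <= size (map phi Z))%N.
  apply: uniq_leq_size => [|_ /mapP[i + ->]].
    rewrite map_inj_uniq ?iota_uniq // => i j /fmorph_inj /eqP.
    rewrite tofrac_eq => /eqP /addrI /(congr1 (size \o polyseq)) /=.
    by rewrite !size_polyXn => -[].
  rewrite mem_iota add0n ltnS /= => iZ.
  apply: contrapT => niZ; apply: no; exists i => // a aE; apply/negP => aZ.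
  by apply: niZ; rewrite /v -aE map_f.
by rewrite !size_map size_iota ltnn.
Qed.

(** With e the degree of A in x, a root of the n-th pullback of 'X - y can be
    taken of height at most deg y / e ^ n + b / (e - 1); the first term is made
    smaller than eps by the choice of n, which comes before that of y. *)
Lemma exists_tadic_in_small_height (R : realType) (S : laurent F -> Prop)
    (A : {poly {poly F}}) (b : nat) :
    (1 < (size A).-1)%N -> (sizeY A <= b.+1)%N ->
    (forall r, S r ->
       splits_in S (map_poly laurent_of_poly A - (laurent_of_poly 'X ^+ b * r)%:P)) ->
    (forall i, S (laurent_of_poly (1 + 'X ^+ i.+1 : {poly F}))) ->
  forall (Z : seq K) (eps : R), 0 < eps ->
  exists a, [/\ a \notin Z, tadic_in S a &
    height iota R a <= b%:R / ((size A).-1%:R - 1) + eps].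
Proof.
move=> e1 Ab AS yS Z eps eps0; set e := (size A).-1 in e1 *.
set N := (size Z).+1.
have [n Nn] : exists n, N%:R <= eps * (e ^ n)%N%:R :> R.
  exists (Num.truncn (N%:R / eps)).+1; rewrite mulrC -ler_pdivrMr //.
  apply: le_trans (ltW (truncnS_gt _)) _; rewrite ler_nat ltnW // ltn_expl //.
have [i iZ ia] := exists_value_outside (iter n (dynamics iota A b)) Z.
set y : {poly F} := 1 + 'X ^+ i.+1 in ia; set P := iter_pullback A b y n.
have dP : (size P).-1 = (e ^ n)%N by rewrite degree_iter_pullback.
have en0 : (0 < e ^ n)%N by rewrite expn_gt0 (ltnW e1).
have P1 : (1 < size P)%N by move: en0; rewrite -dP; case: (size P) => [|[]].
have [a Pa le] := exists_small_height_root alg P1.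
exists a; split; first by apply: ia; apply: root_iter_pullback Pa.
  by apply: tadic_in_root Pa _; apply: splits_in_iter_pullback => //; apply: yS.
have f1 := size_minimal_polynomial a; rewrite /height.
move: f1 le; set f := minimal_polynomial iota a => f1 le.
have df0 : (0 < (size f).-1)%N by case: (size f) f1 => [|[]].
rewrite dP in le.
have sy : ((size y).-1 <= N)%N.
  have := size_polyD 1 ('X ^+ i.+1 : {poly F}); rewrite -/y size_poly1 size_polyXn.
  by move: (size y) => x; rewrite /N; lia.
have mP := degreeY_iter_pullback y n Ab; rewrite -/P -/e in mP.
(* The geometric sum 1 + e + ... + e ^ (n - 1) is (e ^ n - 1) / (e - 1). *)
have geo : ((e.-1) * (\sum_(i < n) e ^ i) <= e ^ n)%N by rewrite -predn_exp leq_pred.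
have enR : 0 < (e ^ n)%N%:R :> R by rewrite ltr0n.
have eR : 0 < e%:R - 1 :> R by rewrite subr_gt0 ltr1n.
apply: (@le_trans _ _ ((sizeY P).-1%:R / (e ^ n)%N%:R)).
  by rewrite ler_pdivrMr ?ltr0n // mulrAC ler_pdivlMr // -!natrM ler_nat.
rewrite ler_pdivrMr //.
apply: (@le_trans _ _ (N%:R + b%:R * (\sum_(i < n) e ^ i)%N%:R)).
  rewrite -natrM -natrD ler_nat; apply: leq_trans mP _; rewrite leq_add2r //.
rewrite addrC mulrDl lerD // mulrAC ler_pdivlMr // -mulrA ler_wpM2l //.
move: geo; rewrite -(ler_nat R) natrM mulrC => geo.
by rewrite -[e](ltn_predK e1) -natr1 addrK (ltn_predK e1).
Qed.

End TotallyTadicIn.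

(** * The three maps *)
Section PullbackFamilies.
Context {F : finFieldType}.
Implicit Types (r : laurent F).
Local Notation T := (laurent_of_poly ('X : {poly F})).

Lemma hensel_family (a b : laurent F) : vanishes_below 1 a -> vanishes_below 1 b ->
  exists rho : F -> laurent F, forall c,
    [/\ vanishes_below 0 (rho c), rho c 0 = c &
        rho c ^+ #|F| = (1 + a) * rho c + b].
Proof. move=> a1 b1.
by have [rho rhoP] := boolp.choice (fun c => hensel c a1 b1); exists rho.
Qed.

Lemma ge_ord_TM r : vanishes_below 0 r -> vanishes_below 1 (T * r).
Proof.
move=> r0; apply: (@vanishes_below_le _ _ (1 + 0)) => //.
exact: ge_ordM ge_ord_T r0.
Qed.

Definition frobenius_poly : {poly {poly F}} := 'X^#|F| - 'X.

Lemma size_frobenius_poly : size frobenius_poly = #|F|.+1.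
Proof.
by rewrite size_polyDl ?size_polyXn // size_polyN size_polyX ltnS card_finField_gt1.
Qed.

Lemma sizeY_frobenius_poly : (sizeY frobenius_poly <= 2)%N.
Proof.
rewrite sizeYE rmorphB rmorphXn /= swapXY_X -rmorphXn -rmorphB /=.
by apply: leq_trans (size_polyC_leq1 _) _.
Qed.

(** x ^ q - x - T r has one root in O for each residue class. *)
Lemma splits_in_frobenius r : vanishes_below 0 r ->
  splits_in (fun x : laurent F => vanishes_below 0 x)
    (map_poly laurent_of_poly frobenius_poly - (T ^+ 1 * r)%:P).
Proof.
move=> r0; have z1 := @ge_ord_zero F 1.
have [rho rhoP] := hensel_family z1 (ge_ord_TM r0).
apply: (@splits_in_roots _ _ _ [seq rho c | c <- enum F]).
- rewrite map_inj_uniq ?enum_uniq // => c d cd.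
  by have [_ <- _] := rhoP c; have [_ <- _] := rhoP d; rewrite cd.
- rewrite size_map -cardE size_polyDl size_laurentP size_frobenius_poly //.
  rewrite size_polyN size_polyC; case: (_ != 0) => //=.
  by rewrite ltnS (ltnW card_finField_gt1).
- move=> _ /mapP[c _ ->]; have [x0 _ xE] := rhoP c; split=> //.
  rewrite rootE rmorphB rmorphXn /= map_polyX !hornerE ?hornerXn.
  by rewrite expr1 xE; apply/eqP; ring.
Qed.

Definition unit_frobenius_poly : {poly {poly F}} := 'X^(#|F|.-1) - 1.

Lemma size_unit_frobenius_poly : size unit_frobenius_poly = #|F|.
Proof.
have q1 := @card_finField_gt1 F; rewrite size_XnsubC; lia.
Qed.

Lemma sizeY_unit_frobenius_poly : (sizeY unit_frobenius_poly <= 2)%N.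
Proof.
rewrite sizeYE rmorphB rmorphXn /= swapXY_X rmorph1 -rmorphXn -[1]polyC1 -rmorphB /=.
by apply: leq_trans (size_polyC_leq1 _) _.
Qed.

(** The roots of x ^ (q - 1) = 1 + T r are the nonzero solutions of
    x ^ q = (1 + T r) x; Hensel's lemma gives one for each nonzero residue. *)
Lemma splits_in_unit_frobenius r : is_order r 0 ->
  splits_in (fun x : laurent F => is_order x 0)
    (map_poly laurent_of_poly unit_frobenius_poly - (T ^+ 1 * r)%:P).
Proof.
move=> [_ r0]; have z1 := @ge_ord_zero F 1.
have q1 := @card_finField_gt1 F.
have [rho rhoP] := hensel_family (ge_ord_TM r0) z1.
apply: (@splits_in_roots _ _ _ [seq rho c | c <- enum (predC1 (0 : F))]).
- rewrite map_inj_uniq ?enum_uniq // => c d cd.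
  by have [_ <- _] := rhoP c; have [_ <- _] := rhoP d; rewrite cd.
- rewrite size_map -cardE cardC1 (ltn_predK q1).
  rewrite size_polyDl size_laurentP size_unit_frobenius_poly //.
  by rewrite size_polyN size_polyC; case: (_ != 0) => //=; apply: ltnW.
- move=> _ /mapP[c + ->]; rewrite mem_enum inE => c0.
  have [x0 xc xE] := rhoP c; split; last by split=> //; rewrite xc.
  have y0 : rho c != 0.
    by apply: contraNneq c0 => E; rewrite -xc E /= coef0.
  rewrite rootE rmorphB rmorphXn rmorph1 /= map_polyX !hornerE ?hornerXn expr1.
  apply/eqP/(mulfI y0); rewrite mulr0 !mulrBr -exprS (ltn_predK q1) xE; ring.
Qed.

(** For q = 2 the polynomial x ^ (q - 1) - 1 has degree 1, and its iterates stay
    of degree 1.  All units being of the form 1 + T beta, one conjugates instead: in terms of beta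
    this polynomial is T ^ 2 (beta ^ 2 - beta + 1), so that dividing it by T ^ 2
    and setting it equal to r leads to beta ^ 2 - beta = r - 1. *)
Definition binary_unit_poly : {poly {poly F}} :=
  ('X - 1%:P) ^+ 2 - 'X%:P * ('X - 1%:P) + ('X ^+ 2)%:P.

Lemma size_binary_unit_poly : size binary_unit_poly = 3%N.
Proof.
rewrite /binary_unit_poly -addrA size_polyDl size_exp_XsubC // ltnS.
apply: leq_trans (size_polyD _ _) _; rewrite geq_max size_polyN mul_polyC.
apply/andP; split; last by apply: leq_trans (size_polyC_leq1 _) _.
by apply: leq_trans (size_scale_leq _ _) _; rewrite size_XsubC.
Qed.

Lemma sizeY_binary_unit_poly : (sizeY binary_unit_poly <= 3)%N.
Proof.
have -> : sizeY binary_unit_poly =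
    size (('X - 1)%:P ^+ 2 - 'X * ('X - 1)%:P + 'X ^+ 2 : {poly {poly F}}).
  rewrite sizeYE rmorphD rmorphB rmorphXn rmorphM /= rmorphB /= swapXY_X.
  by rewrite !swapXY_polyC !map_polyC /= map_polyX map_polyXn rmorphB.
apply: leq_trans (size_polyD _ _) _; rewrite geq_max size_polyXn leqnn andbT.
apply: leq_trans (size_polyD _ _) _; rewrite geq_max size_polyN -rmorphXn /=.
apply/andP; split; first by apply: leq_trans (size_polyC_leq1 _) _.
rewrite mulrC mul_polyC; apply: leq_trans (size_scale_leq _ _) _.
by rewrite size_polyX.
Qed.

Lemma splits_in_binary_unit r : #|F| = 2%N -> is_order r 0 ->
  splits_in (fun x : laurent F => is_order x 0)
    (map_poly laurent_of_poly binary_unit_poly - (T ^+ 2 * r)%:P).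
Proof.
move=> q2 [rn r0].
(* The only nonzero element of F is 1, whence r - 1 is divisible by T. *)
have r1 : r 0 = 1.
  by have := expf_card (r 0); rewrite q2 expr2 => /(canRL (mulfK rn)); rewrite mulfV.
have b1 : vanishes_below 1 (r - 1).
  by apply: ge_ord1; [apply: ge_ordB r0 _; apply: ge_ord0_poly|rewrite /= r1 coef1 subrr].
have [rho rhoP] := hensel_family (@ge_ord_zero F 1) b1.
have TM c : vanishes_below 1 (T * rho c).
  by have [x0 _ _] := rhoP c; apply: ge_ord_TM.
apply: (@splits_in_roots _ _ _ [seq 1 + T * rho c | c <- enum F]).
- rewrite map_inj_uniq ?enum_uniq // => c d /addrI /(mulfI (@laurentT_neq0 F)) cd.
  by have [_ <- _] := rhoP c; have [_ <- _] := rhoP d; rewrite cd.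
- rewrite size_map -cardE q2 size_polyDl size_laurentP size_binary_unit_poly //.
  by rewrite size_polyN size_polyC; case: (_ != 0).
- move=> _ /mapP[c _ ->]; have [x0 _ xE] := rhoP c; split; last first.
    split.
      have -> : (1 + T * rho c) 0 = (1 : laurent F) 0 + (T * rho c) 0 by [].
      by rewrite (TM c) //= coef1 addr0 oner_neq0.
    apply: ge_ordD; first exact: ge_ord0_poly.
    exact: vanishes_below_le (TM c).
  have -> : map_poly laurent_of_poly binary_unit_poly =
      ('X - 1%:P) ^+ 2 - T%:P * ('X - 1%:P) + (T ^+ 2)%:P.
    rewrite rmorphD rmorphB rmorphXn rmorphM /= rmorphB /= map_polyX !map_polyC /=.
    by rewrite rmorphXn.
  rewrite rootE !hornerE.
  rewrite q2 in xE; have -> : r = 1 + (r - 1) by ring.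
  have -> : r - 1 = rho c ^+ 2 - rho c by rewrite xE; ring.
  by apply/eqP; ring.
Qed.

End PullbackFamilies.

(** * Lower limits along an enumeration *)
Section Liminf.
Context {K : nmodType} {R : realType}.
Implicit Types (L : set K) (h : K -> R) (c : R).

(** The default value of ordering is never used for the sets considered: a
    countable set that no finite sequence exhausts has an enumeration. *)
Lemma orderingP L : countable L -> (forall Z : seq K, exists2 a, a \notin Z & L a) ->
  set_bij [set: nat] L (ordering L).
Proof.
move=> cL Lout; rewrite /ordering; case: xgetP => [_ _ //|no].
have infL : ~ finite_set L.
  move=> /finite_seqP[Z LZ]; have [a aZ La] := Lout Z.
  by move: La aZ; rewrite LZ /= => ->.
pose KP : pointedType := HB.pack (GRing.Nmodule.sort K) (isPointed.Build K 0).
have /card_esym := eq_card_nat cL infL.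
by move=> /(@card_set_bijP _ KP) [e eL]; case: (no e).
Qed.

Lemma liminf_over_ge L h c (Z : seq K) : set_bij [set: nat] L (ordering L) ->
    (forall a, L a -> a \notin Z -> c <= h a) ->
  (c%:E <= liminf_over L h)%E.
Proof.
move=> [eL einj _] hc; rewrite /liminf_over limn_einf_lim.
apply: lime_ge; first exact: is_cvg_einfs.
(* An enumeration without repetition leaves every finite set for good. *)
have [N NZ] : exists N, forall n, (N <= n)%N -> ordering L n \notin Z.
  elim: Z {hc} => [|z Z [N NZ]]; first by exists 0%N.
  have [[m mz]|nz] := pselect (exists m, ordering L m = z).
    exists (maxn N m.+1) => n; rewrite geq_max => /andP[Nn mn].
    rewrite in_cons negb_or NZ // andbT; apply/eqP => nz.
    have : n = m by apply: einj; rewrite ?inE // nz mz.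
    by move=> E; rewrite E ltnn in mn.
  exists N => n Nn; rewrite in_cons negb_or NZ // andbT; apply/eqP => E.
  by apply: nz; exists n.
exists N => // n /= Nn; apply: le_ereal_inf_tmp => _ [m /= nm <-].
by rewrite lee_fin; apply: hc; [apply: eL|apply: NZ; apply: leq_trans nm].
Qed.

Lemma liminf_over_le L h c : set_bij [set: nat] L (ordering L) ->
    (forall (Z : seq K) eps, 0 < eps -> exists a, [/\ a \notin Z, L a & h a <= c + eps]) ->
  (liminf_over L h <= c%:E)%E.
Proof.
move=> [_ _ esurj] hc; rewrite /liminf_over limn_einf_lim.
apply: lime_le; first exact: is_cvg_einfs.
exists 0%N => // n _; apply/lee_addgt0Pr => eps eps0.
have [a [aZ La ha]] := hc [seq ordering L i | i <- iota 0 n] eps eps0.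
have [m _ ma] := esurj a La; rewrite -EFinD.
apply: le_trans (_ : (h a)%:E <= _)%E; last by rewrite lee_fin.
apply: ereal_inf_lbound; exists m; last by rewrite ma.
rewrite /= leqNgt; apply: contra aZ => mn.
by rewrite -ma map_f // mem_iota.
Qed.

End Liminf.

(** Every element is a root of one of countably many nonzero polynomials, each of
    which has finitely many roots. *)
Lemma countable_algebraic (F : finFieldType) (K : closedFieldType)
    (iota : {rmorphism {fraction {poly F}} -> K}) (L : set K) :
  is_algebraic_closure iota -> countable L.
Proof.
move=> alg.
have : countable (\bigcup_(f in [set: {poly {poly F}}])
    [set a | evalK iota f != 0 /\ root (evalK iota f) a])%classic.
  apply: bigcup_countable => [|f _]; first exact: countableP.
  apply: finite_set_countable.
  have [f0|f0] := eqVneq (evalK iota f) 0.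
    by apply: sub_finite_set (finite_set0 K) => a [].
  have [rs rsE] := closed_field_poly_normal (evalK iota f).
  apply/finite_seqP; exists rs; apply/seteqP; split=> a /=.
    by case=> _; rewrite rsE rootZ ?lead_coef_eq0 // root_prod_XsubC.
  by move=> ars; split=> //; rewrite rsE rootZ ?lead_coef_eq0 // root_prod_XsubC.
apply: sub_countable; apply: subset_card_le => a _.
exists (minimal_polynomial iota a) => //.
have [irr fa _ _] := minimal_polynomialP a alg; rewrite /= evalKE; split=> //.
by rewrite map_poly_eq0 (irredp_neq0 irr).
Qed.

(** * The bounds *)
Section Bounds.
Context {F : finFieldType} {K : closedFieldType} {R : realType}.
Context (iota : {rmorphism {fraction {poly F}} -> K}).
Hypothesis alg : is_algebraic_closure iota.

Lemma is_order_base_point i :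
  is_order (laurent_of_poly (1 + 'X ^+ i.+1 : {poly F})) 0.
Proof.
split; last exact: ge_ord0_poly.
by rewrite /= coefD coef1 coefXn addr0 oner_neq0.
Qed.

Lemma exists_integral_Tadic_small_height (Z : seq K) (eps : R) : 0 < eps ->
  exists a, [/\ a \notin Z, integral_Tadic iota a &
    height iota R a <= (#|F|%:R - 1)^-1 + eps].
Proof.
move=> eps0; have q1 := @card_finField_gt1 F.
have [|||i|a [aZ aS ha]] := @exists_tadic_in_small_height _ _ _ alg R
  (fun x : laurent F => vanishes_below 0 x) (@frobenius_poly F) 1 _ _ _ _ Z eps eps0.
- by rewrite size_frobenius_poly.
- exact: sizeY_frobenius_poly.
- exact: splits_in_frobenius.
- exact: ge_ord0_poly.
exists a; split=> //.
  by case: aS => aT aS; split=> // b /aS /ord0_ge0.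
by move: ha; rewrite size_frobenius_poly mul1r.
Qed.

Lemma exists_unit_Tadic_small_height (Z : seq K) (eps : R) : 0 < eps ->
  exists a, [/\ a \notin Z, unit_Tadic iota a &
    height iota R a <=
      (if #|F| != 2%N then (#|F|%:R - 2)^-1 else 2) + eps].
Proof.
move=> eps0; have q1 := @card_finField_gt1 F.
have unitE a : tadic_in iota (fun x : laurent F => is_order x 0) a -> unit_Tadic iota a.
  by case=> aT aS; split=> // b /aS /ord0_eq0.
have [q2|q2] := eqVneq #|F| 2%N.
  have [|||i|a [aZ aS ha]] := @exists_tadic_in_small_height _ _ _ alg R
    (fun x : laurent F => is_order x 0) (@binary_unit_poly F) 2 _ _ _ _ Z eps eps0.
  - by rewrite size_binary_unit_poly.
  - exact: sizeY_binary_unit_poly.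
  - by move=> r; apply: splits_in_binary_unit.
  - exact: is_order_base_point.
  exists a; split=> //; first exact: unitE.
  by move: ha; rewrite size_binary_unit_poly /= -[2%:R - 1]/(1 + 1 - 1) addrK divr1.
have [|||i|a [aZ aS ha]] := @exists_tadic_in_small_height _ _ _ alg R
  (fun x : laurent F => is_order x 0) (@unit_frobenius_poly F) 1 _ _ _ _ Z eps eps0.
- by rewrite size_unit_frobenius_poly; lia.
- exact: sizeY_unit_frobenius_poly.
- exact: splits_in_unit_frobenius.
- exact: is_order_base_point.
exists a; split=> //; first exact: unitE.
move: ha; rewrite size_unit_frobenius_poly mul1r.
have -> // : #|F|%:R - 2 = #|F|.-1%:R - 1 :> R.
by rewrite -[in LHS](ltn_predK q1) -natr1; ring.
Qed.

Lemma integral_Tadic_height_ge a : integral_Tadic iota a ->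
    a \notin [seq iota (tofrac c%:P) | c <- enum F] ->
  #|F|%:R^-1 <= height iota R a.
Proof.
move=> [aT aS] aF; rewrite cardE; apply: residue_height_bound => // [b /aS /ord0_ge0 b0|c cF].
  by rewrite mem_enum.
by apply: contraNneq aF => ->; apply: map_f.
Qed.

Lemma unit_Tadic_height_ge a : unit_Tadic iota a ->
    a \notin [seq iota (tofrac c%:P) | c <- enum F] ->
  (#|F|%:R - 1)^-1 <= height iota R a.
Proof.
move=> [aT aS] aF.
have -> : #|F|%:R - 1 = (size (enum (predC1 (0 : F))))%:R :> R.
  by rewrite -cardE cardC1 -[in LHS](ltn_predK (@card_finField_gt1 F)) -natr1 addrK.
apply: residue_height_bound => // [b /aS /ord0_eq0[bn b0]|c _].
  by rewrite mem_enum.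
by apply: contraNneq aF => ->; apply: map_f; rewrite mem_enum.
Qed.

End Bounds.

Theorem theoremE (R : realType) (q : nat) (F : finFieldType) (hq : #|F| = q)
    (K : closedFieldType) (iota : {rmorphism {fraction {poly F}} -> K})
    (hK : is_algebraic_closure iota) :
  ((q%:R^-1)%:E <= liminf_over (integral_Tadic iota) (height iota R)
     <= ((q%:R - 1)^-1)%:E)%E
  /\
  (((q%:R - 1)^-1)%:E <= liminf_over (unit_Tadic iota) (height iota R)
     <= (if q != 2%N then (q%:R - 2)^-1 else 2)%:E)%E.
Proof.
subst q; set Z := [seq iota (tofrac c%:P) | c <- enum F].
have Ibij : set_bij [set: nat] (integral_Tadic iota) (ordering (integral_Tadic iota)).
  apply: orderingP => [|Y]; first exact: countable_algebraic hK.
  by have [a [aY La _]] := exists_integral_Tadic_small_height hK Y (@ltr01 R); exists a.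
have Ubij : set_bij [set: nat] (unit_Tadic iota) (ordering (unit_Tadic iota)).
  apply: orderingP => [|Y]; first exact: countable_algebraic hK.
  by have [a [aY La _]] := exists_unit_Tadic_small_height hK Y (@ltr01 R); exists a.
split; apply/andP; split.
- by apply: (liminf_over_ge (Z := Z)) => // a; apply: integral_Tadic_height_ge.
- apply: liminf_over_le => // Y eps; exact: exists_integral_Tadic_small_height.
- by apply: (liminf_over_ge (Z := Z)) => // a; apply: unit_Tadic_height_ge.
- apply: liminf_over_le => // Y eps; exact: exists_unit_Tadic_small_height.
Qed.
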